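(* Let $(\Sigma,\mathscr R)$ be a Dedukti theory with $\hookrightarrow_{\beta\mathscr R}$ confluent and $\mathscr R$ arity-preserving. If $\Sigma;\Gamma\vdash M:A$ and $A\neq\mathtt{KIND}$, then there is $\Sigma'\subseteq\Sigma$ such that $\Gamma_\pi,\|\Sigma'\|,\|\Gamma\|\vdash_\lambda|M|:\|A\|$ in the simply-typed $\lambda$-calculus.
   Context: Dedukti terms $x\mid c[\vec M]\mid\mathtt{TYPE}\mid\mathtt{KIND}\mid MN\mid\lambda x:A.M\mid\Pi x:A.B$ (constants of fixed arity), signatures of declarations $c[\Delta]:A$, rewrite rules $c[\vec l]\hookrightarrow r$, $\equiv$ generated by $\beta$ and the rules; typing by the rules Empty, Decl ($A:\mathtt{TYPE}$), Cons ($c[\Delta]:A\in\Sigma$, $\Sigma;\Delta\vdash A:s$, arguments $\vec M$ typed sequentially against $\Delta$ give $c[\vec M]:A\{\vec M\}$), Sort ($\mathtt{TYPE}:\mathtt{KIND}$), Var, Conv (modulo $\equiv$, target type of sort $s\in\{\mathtt{TYPE},\mathtt{KIND}\}$), Prod ($A:\mathtt{TYPE}$, $x:A\vdash B:s$ give $\Pi x:A.B:s$), App, Abs ($A:\mathtt{TYPE}$, $x:A\vdash B:s$, $x:A\vdash M:B$ give $\lambda x:A.M:\Pi x:A.B$). A constant is type-level (written $\alpha$) if its declared type has the form $\Pi\vec x:\vec B.\mathtt{TYPE}$, otherwise object-level ($a$); a rule is type-level if its head is. $\mathscr R$ is arity-preserving if every type-level rule has right-hand side in $R::=\alpha[\vec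 M]\mid R\,N\mid\lambda x:A.R$. Simple types $\sigma::=*\mid\sigma\to\sigma$; $\Gamma_\pi$ declares $\pi_\sigma:*\to(\sigma\to* )\to*$ for every $\sigma$. Partial maps: $\|\mathtt{TYPE}\|=*$, $\|\alpha[\vec M]\|=*$, $\|\Pi x:A.B\|=\|A\|\to\|B\|$, $\|A\,N\|=\|A\|$, $\|\lambda x:A.B\|=\|B\|$ (undefined otherwise); $|x|=x$, $|c[M_1,\dots,M_n]|=c\,|M_1|\cdots|M_n|$, $|MN|=|M|\,|N|$, $|\lambda x:A.M|=(\lambda z.\lambda x.|M|)\,|A|$ with $z$ fresh, $|\Pi x:A.B|=\pi_{\|A\|}\,|A|\,(\lambda x.|B|)$. On contexts $\|x:A,\Gamma\|=x:\|A\|,\|\Gamma\|$; on signatures $\|c[x_1:A_1,\dots,x_n:A_n]:A\|=c:\|A_1\|\to\cdots\to\|A_n\|\to\|A\|$. *)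

(* Defs.v *)
From Stdlib Require Import List Relations.
Import ListNotations.

Set Implicit Arguments.
Unset Strict Implicit.

Record constants := Constants { cst :> Type; arity : cst -> nat }.

Inductive sort := TYPE | KIND.

(* Terms use de Bruijn indices.  The argument vector of a constant is indexed
   by its arity and grows on the right: [M_1, ..., M_n] is
   snoc (... (snoc anil M_1) ...) M_n. *)
Inductive term (C : constants) : Type :=
| Var (i : nat)
| Cst (c : C) (ms : args C (arity c))
| Srt (s : sort)
| App (M N : term C)
| Lam (A M : term C)
| Prod (A B : term C)
with args (C : constants) : nat -> Type :=
| anil : args C 0
| snoc n (ms : args C n) (M : term C) : args C (S n).

Arguments Var {C} i.
Arguments Srt {C} s.
Arguments anil {C}.

Section Substitution.
Context {C : constants}.

Definition scons {T : Type} (a : T) (f : nat -> T) (i : nat) : T :=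
  match i with 0 => a | S j => f j end.

Definition up_ren (r : nat -> nat) : nat -> nat := scons 0 (fun i => S (r i)).

Fixpoint ren (r : nat -> nat) (M : term C) {struct M} : term C :=
  match M with
  | Var i => Var (r i)
  | Cst ms => Cst (ren_args r ms)
  | Srt s => Srt s
  | App M N => App (ren r M) (ren r N)
  | Lam A M => Lam (ren r A) (ren (up_ren r) M)
  | Prod A B => Prod (ren r A) (ren (up_ren r) B)
  end
with ren_args (r : nat -> nat) n (ms : args C n) {struct ms} : args C n :=
  match ms with
  | anil => anil
  | snoc ms M => snoc (ren_args r ms) (ren r M)
  end.

Definition up (s : nat -> term C) : nat -> term C :=
  scons (Var 0) (fun i => ren S (s i)).

Fixpoint subst (s : nat -> term C) (M : term C) {struct M} : term C :=
  match M with
  | Var i => s i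
  | Cst ms => Cst (subst_args s ms)
  | Srt s => Srt s
  | App M N => App (subst s M) (subst s N)
  | Lam A M => Lam (subst s A) (subst (up s) M)
  | Prod A B => Prod (subst s A) (subst (up s) B)
  end
with subst_args (s : nat -> term C) n (ms : args C n) {struct ms} : args C n :=
  match ms with
  | anil => anil
  | snoc ms M => snoc (subst_args s ms) (subst s M)
  end.

(* M{N/x}, for x the variable of index 0 *)
Definition subst1 (N M : term C) : term C := subst (scons N Var) M.

(* The substitution {M_1/x_1, ..., M_n/x_n}, where x_n has index 0. *)
Fixpoint inst n (ms : args C n) : nat -> term C :=
  match ms with
  | anil => Var
  | snoc ms M => scons M (inst ms)
  end.

End Substitution.

(* The head of the list is the most recent entry (index 0), and each type lives
   in the context formed by the tail. *)
Definition ctx (C : constants) := list (term C).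

(* S c = Some (D, A) stands for the entry c[D] : A.  A signature declares a
   constant at most once; it need not be finite. *)
Definition signature (C : constants) := C -> option (ctx C * term C).

Definition is_signature (C : constants) (S : signature C) : Prop :=
  forall c D A, S c = Some (D, A) -> length D = arity c.

Definition sub_signature (C : constants) (S' S : signature C) : Prop :=
  forall c d, S' c = Some d -> S c = Some d.

(* R c ls r stands for the rule c[ls] --> r; the variables of the rule are the
   free de Bruijn indices of ls and r. *)
Definition rules (C : constants) :=
  forall c : C, args C (arity c) -> term C -> Prop.

Inductive step (C : constants) (R : rules C) : term C -> term C -> Prop :=
| step_beta A M N : step R (App (Lam A M) N) (subst1 N M)
| step_rule c (ls : args C (arity c)) r (s : nat -> term C) :
    R c ls r -> step R (Cst (subst_args s ls)) (subst s r)
| step_cst c (ms ms' : args C (arity c)) :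
    step_args R ms ms' -> step R (Cst ms) (Cst ms')
| step_appl M M' N : step R M M' -> step R (App M N) (App M' N)
| step_appr M N N' : step R N N' -> step R (App M N) (App M N')
| step_laml A A' M : step R A A' -> step R (Lam A M) (Lam A' M)
| step_lamr A M M' : step R M M' -> step R (Lam A M) (Lam A M')
| step_prodl A A' B : step R A A' -> step R (Prod A B) (Prod A' B)
| step_prodr A B B' : step R B B' -> step R (Prod A B) (Prod A B')
with step_args (C : constants) (R : rules C) :
    forall n, args C n -> args C n -> Prop :=
| step_init n (ms ms' : args C n) M :
    step_args R ms ms' -> step_args R (snoc ms M) (snoc ms' M)
| step_last n (ms : args C n) M M' :
    step R M M' -> step_args R (snoc ms M) (snoc ms M').

Definition steps (C : constants) (R : rules C) := clos_refl_trans _ (step R).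
Definition conv (C : constants) (R : rules C) := clos_refl_sym_trans _ (step R).

Definition confluent (C : constants) (R : rules C) : Prop :=
  forall M N P, steps R M N -> steps R M P ->
    exists Q, steps R N Q /\ steps R P Q.

(* wt_args S R G ms D types ms sequentially against D.  The premise wf S R G of
   wt_cst is only useful when ms is empty: it ensures that every derivable
   judgment has a well-formed context. *)
Inductive wf (C : constants) (S : signature C) (R : rules C) : ctx C -> Prop :=
| wf_empty : wf S R []
| wf_decl G A : wf S R G -> wt S R G A (Srt TYPE) -> wf S R (A :: G)
with wt (C : constants) (S : signature C) (R : rules C) :
    ctx C -> term C -> term C -> Prop :=
| wt_cst G c D A s (ms : args C (arity c)) :
    wf S R G -> S c = Some (D, A) -> wt S R D A (Srt s) ->
    wt_args S R G ms D -> wt S R G (Cst ms) (subst (inst ms) A)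
| wt_sort G : wf S R G -> wt S R G (Srt TYPE) (Srt KIND)
| wt_var G i A :
    wf S R G -> nth_error G i = Some A ->
    wt S R G (Var i) (ren (fun k => Datatypes.S i + k) A)
| wt_conv G M A B s :
    wt S R G M A -> wt S R G B (Srt s) -> conv R A B -> wt S R G M B
| wt_prod G A B s :
    wt S R G A (Srt TYPE) -> wt S R (A :: G) B (Srt s) ->
    wt S R G (Prod A B) (Srt s)
| wt_app G M N A B :
    wt S R G M (Prod A B) -> wt S R G N A ->
    wt S R G (App M N) (subst1 N B)
| wt_abs G A B M s :
    wt S R G A (Srt TYPE) -> wt S R (A :: G) B (Srt s) ->
    wt S R (A :: G) M B -> wt S R G (Lam A M) (Prod A B)
with wt_args (C : constants) (S : signature C) (R : rules C) :
    ctx C -> forall n, args C n -> ctx C -> Prop :=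
| wt_nil G : wt_args S R G anil []
| wt_snoc G n (ms : args C n) M D A :
    wt_args S R G ms D -> wt S R G M (subst (inst ms) A) ->
    wt_args S R G (snoc ms M) (A :: D).

Fixpoint prods_to_type (C : constants) (A : term C) : bool :=
  match A with
  | Srt TYPE => true
  | Prod _ B => prods_to_type B
  | _ => false
  end.

Definition type_level (C : constants) (S : signature C) (c : C) : bool :=
  match S c with
  | Some (_, A) => prods_to_type A
  | None => false
  end.

Inductive arity_form (C : constants) (S : signature C) : term C -> Prop :=
| arity_cst c (ms : args C (arity c)) :
    type_level S c = true -> arity_form S (Cst ms)
| arity_app M N : arity_form S M -> arity_form S (App M N)
| arity_lam A M : arity_form S M -> arity_form S (Lam A M).

Definition arity_preserving (C : constants) (S : signature C) (R : rules C) :=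
  forall c (ls : args C (arity c)) r,
    type_level S c = true -> R c ls r -> arity_form S r.

(* Simply-typed lambda-calculus, Curry style.  Bound variables are de Bruijn
   indices; the globally declared names are the elements of X. *)
Inductive stype := star | arrow (s t : stype).

Inductive lterm (X : Type) : Type :=
| LName (x : X)
| LVar (i : nat)
| LApp (t u : lterm X)
| LLam (t : lterm X).

Arguments LVar {X} i.

Fixpoint lren (X : Type) (r : nat -> nat) (t : lterm X) : lterm X :=
  match t with
  | LName x => LName x
  | LVar i => LVar (r i)
  | LApp t u => LApp (lren r t) (lren r u)
  | LLam t => LLam (lren (up_ren r) t)
  end.

Definition lshift (X : Type) (t : lterm X) : lterm X := lren S t.

Definition names_ctx (X : Type) := X -> stype -> Prop.

Definition cat_names (X : Type) (P Q : names_ctx X) : names_ctx X :=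
  fun x s => P x s \/ Q x s.

Inductive lwt (X : Type) (P : names_ctx X) :
    list stype -> lterm X -> stype -> Prop :=
| lwt_name g x s : P x s -> lwt P g (LName x) s
| lwt_var g i s : nth_error g i = Some s -> lwt P g (LVar i) s
| lwt_app g t u s s' :
    lwt P g t (arrow s s') -> lwt P g u s -> lwt P g (LApp t u) s'
| lwt_lam g t s s' : lwt P (s :: g) t s' -> lwt P g (LLam t) (arrow s s').

Inductive name (C : constants) :=
| NPi (s : stype)
| NCst (c : C).

Arguments NPi {C} s.

Section Translation.
Context {C : constants}.
Variable S : signature C.

Definition pi_ctx : names_ctx (name C) := fun x t =>
  exists s, x = NPi s /\ t = arrow star (arrow (arrow s star) star).

(* ||A|| *)
Fixpoint ty_tr (A : term C) : option stype :=
  match A with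
  | Srt TYPE => Some star
  | @Cst _ c _ => if type_level S c then Some star else None
  | Prod A B =>
      match ty_tr A, ty_tr B with
      | Some a, Some b => Some (arrow a b)
      | _, _ => None
      end
  | App A _ => ty_tr A
  | Lam _ B => ty_tr B
  | Srt KIND | Var _ => None
  end.

(* |M|.  For an abstraction the shift makes the outer bound variable z fresh. *)
Fixpoint tm_tr (M : term C) {struct M} : option (lterm (name C)) :=
  match M with
  | Var i => Some (LVar i)
  | @Cst _ c ms => args_tr (LName (NCst c)) ms
  | App M N =>
      match tm_tr M, tm_tr N with
      | Some m, Some n => Some (LApp m n)
      | _, _ => None
      end
  | Lam A M =>
      match tm_tr A, tm_tr M with
      | Some a, Some m => Some (LApp (LLam (lshift (LLam m))) a)
      | _, _ => None
      end
  | Prod A B =>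
      match ty_tr A, tm_tr A, tm_tr B with
      | Some s, Some a, Some b =>
          Some (LApp (LApp (LName (NPi s)) a) (LLam b))
      | _, _, _ => None
      end
  | Srt _ => None
  end
(* h |M_1| ... |M_n| *)
with args_tr (h : lterm (name C)) n (ms : args C n) {struct ms} :
    option (lterm (name C)) :=
  match ms with
  | anil => Some h
  | snoc ms M =>
      match args_tr h ms, tm_tr M with
      | Some t, Some m => Some (LApp t m)
      | _, _ => None
      end
  end.

(* ||G|| *)
Fixpoint ctx_tr (G : ctx C) : option (list stype) :=
  match G with
  | [] => Some []
  | A :: G =>
      match ty_tr A, ctx_tr G with
      | Some a, Some g => Some (a :: g)
      | _, _ => None
      end
  end.

(* ||A_1|| -> ... -> ||A_n|| -> ||A||; the head of D is A_n *)
Definition decl_tr (D : ctx C) (A : term C) : option stype :=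
  match ctx_tr D, ty_tr A with
  | Some ds, Some a => Some (fold_left (fun t d => arrow d t) ds a)
  | _, _ => None
  end.

(* ||S'|| is defined when every entry of S' has a translation.  The translation
   depends on the ambient signature S, which tells which constants are
   type-level. *)
Definition sig_tr_defined (S' : signature C) : Prop :=
  forall c D A, S' c = Some (D, A) -> exists t, decl_tr D A = Some t.

Definition sig_tr (S' : signature C) : names_ctx (name C) := fun x t =>
  exists c D A, x = NCst c /\ S' c = Some (D, A) /\ decl_tr D A = Some t.

End Translation.

(* Main.v *)
(** The partial map [ty_tr] is stable under substitution and, for an
    arity-preserving system, under reduction: the head of a term with a
    translation is never a variable, and a type-level rule rewrites [star] to
    [star].  By confluence, convertible terms with translations have the same
    one.  The same holds of the boolean [targets_type], which tells whether the
    rightmost leaf of a classifier is TYPE.  It separates the terms of a kind,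
    which are type families and have a translation as types, from the objects,
    without any appeal to subject reduction, which may fail here.  One induction
    on derivations then carries both the stratification and the simple typing.
    The signature [S'] consists of all the declarations that have a
    translation. *)
Require Import Defs.
From Stdlib Require Import List Relations.
Import ListNotations.

Scheme wf_mut := Induction for wf Sort Prop
  with wt_mut := Induction for wt Sort Prop
  with wt_args_mut := Induction for wt_args Sort Prop.
Combined Scheme typing_mutind from wf_mut, wt_mut, wt_args_mut.

(** * Weakening in the simply-typed calculus *)

Lemma lwt_lren (X : Type) (P : names_ctx X) g t s :
  lwt P g t s ->
  forall g' r,
    (forall i a, nth_error g i = Some a -> nth_error g' (r i) = Some a) ->
    lwt P g' (lren r t) s.
Proof.
  induction 1; intros g' r Hr; simpl.
  - now apply lwt_name.
  - now apply lwt_var, Hr.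
  - eapply lwt_app; eauto.
  - apply lwt_lam, IHlwt. intros [|i] a; simpl; auto.
Qed.

Lemma lwt_lshift (X : Type) (P : names_ctx X) g t s a :
  lwt P g t s -> lwt P (a :: g) (lshift t) s.
Proof. intros H. apply (lwt_lren _ _ _ _ _ H). auto. Qed.

(** Unlike [prods_to_type], this also descends through applications and abstractions, along the path
    of [ty_tr], so that a beta step cannot change its value where [ty_tr] is defined. *)
Fixpoint targets_type {C : constants} (A : term C) : bool :=
  match A with
  | Srt TYPE => true
  | Prod _ B => targets_type B
  | App A _ => targets_type A
  | Lam _ B => targets_type B
  | _ => false
  end.

(** * Type translation under renaming and substitution *)

Lemma ty_tr_prod_inv (C : constants) (S : signature C) A B a :
  ty_tr S (Prod A B) = Some a ->
  exists b c, ty_tr S A = Some b /\ ty_tr S B = Some c /\ a = arrow b c.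
Proof.
  simpl. destruct (ty_tr S A) as [b|], (ty_tr S B) as [c|]; try discriminate.
  intros [= <-]; eauto.
Qed.

Lemma ty_tr_ren (C : constants) (S : signature C) A r :
  ty_tr S (ren r A) = ty_tr S A.
Proof.
  revert r; induction A; intros r; simpl; auto.
  now rewrite IHA1, IHA2.
Qed.

Lemma targets_type_ren (C : constants) (A : term C) r :
  targets_type (ren r A) = targets_type A.
Proof. revert r; induction A; intros r; simpl; auto. Qed.

Lemma ty_tr_subst (C : constants) (S : signature C) A s a :
  ty_tr S A = Some a -> ty_tr S (subst s A) = Some a.
Proof.
  revert s a; induction A; intros s0 a H; simpl in *; auto; try discriminate.
  destruct (ty_tr S A1) as [b|], (ty_tr S A2) as [c|]; try discriminate.
  now rewrite (IHA1 _ _ eq_refl), (IHA2 _ _ eq_refl).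
Qed.

(** The hypothesis excludes a variable at the rightmost leaf, where a substitution could insert
    [TYPE]. *)
Lemma targets_type_subst (C : constants) (S : signature C) A s a :
  ty_tr S A = Some a -> targets_type (subst s A) = targets_type A.
Proof.
  revert s a; induction A; intros s0 a H; simpl in *; eauto; try discriminate.
  destruct (ty_tr S A1), (ty_tr S A2); try discriminate; eauto.
Qed.

(** * Invariance under reduction and conversion *)

Lemma arity_form_ty_tr (C : constants) (S : signature C) M :
  arity_form S M -> ty_tr S M = Some star /\ targets_type M = false.
Proof. induction 1 as [c ms H| |]; simpl; auto. now rewrite H. Qed.

(** Neither map inspects arguments or the domains of abstractions, so a step inside those is
    invisible. *)
Lemma step_ty_tr (C : constants) (S : signature C) (R : rules C)
  (har : arity_preserving S R) A B :
  step R A B -> forall a, ty_tr S A = Some a ->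
  ty_tr S B = Some a /\ targets_type B = targets_type A.
Proof.
  induction 1; intros a Ha; simpl in *; auto.
  - split; [now apply ty_tr_subst | eapply targets_type_subst; eauto].
  - destruct (type_level S c) eqn:Hc; [|discriminate].
    injection Ha as <-.
    destruct (arity_form_ty_tr _ _ _ (har _ _ _ Hc H)) as [Hr Hk].
    split; [now apply ty_tr_subst|].
    now rewrite (targets_type_subst _ _ _ _ _ Hr).
  - destruct (ty_tr S A) as [b|], (ty_tr S B) as [c|]; try discriminate.
    now destruct (IHstep _ eq_refl) as [-> _].
  - destruct (ty_tr S A) as [b|], (ty_tr S B) as [c|]; try discriminate.
    now destruct (IHstep _ eq_refl) as [-> ->].
Qed.

Lemma steps_ty_tr (C : constants) (S : signature C) (R : rules C)
  (har : arity_preserving S R) A B :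
  steps R A B -> forall a, ty_tr S A = Some a ->
  ty_tr S B = Some a /\ targets_type B = targets_type A.
Proof.
  induction 1 as [A B H|A|A B D _ IH1 _ IH2]; intros a Ha; auto.
  - now apply (step_ty_tr _ _ _ har _ _ H).
  - destruct (IH1 _ Ha) as [Hb <-]; auto.
Qed.

Lemma conv_joinable (C : constants) (R : rules C) (hconf : confluent R) A B :
  conv R A B -> exists Q, steps R A Q /\ steps R B Q.
Proof.
  induction 1 as [A B H|A|A B _ (Q & HA & HB)|A B D _ (Q & HA & HB) _ (Q' & HB' & HD)].
  - exists B; split; [now apply rt_step | apply rt_refl].
  - exists A; split; apply rt_refl.
  - now exists Q.
  - destruct (hconf _ _ _ HB HB') as (Q'' & H1 & H2).
    exists Q''; split; eapply rt_trans; eauto.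
Qed.

Lemma conv_ty_tr (C : constants) (S : signature C) (R : rules C)
  (hconf : confluent R) (har : arity_preserving S R) A B a b :
  conv R A B -> ty_tr S A = Some a -> ty_tr S B = Some b ->
  a = b /\ targets_type A = targets_type B.
Proof.
  intros H HA HB.
  destruct (conv_joinable _ _ hconf _ _ H) as (Q & H1 & H2).
  destruct (steps_ty_tr _ _ _ har _ _ H1 _ HA) as [Ha <-].
  destruct (steps_ty_tr _ _ _ har _ _ H2 _ HB) as [Hb <-].
  split; congruence.
Qed.

Lemma steps_srt (C : constants) (R : rules C) A B :
  steps R A B -> forall s, A = Srt s -> B = Srt s.
Proof.
  induction 1 as [A B H|A|A B D _ IH1 _ IH2]; intros s ->; auto.
  inversion H.
Qed.

(** [KIND] is normal, so [B] would reduce to [KIND], which has no translation. Hence the conversion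
    rule never applies to a term of type [KIND]. *)
Lemma conv_kind_ty_tr (C : constants) (S : signature C) (R : rules C)
  (hconf : confluent R) (har : arity_preserving S R) B b :
  conv R (Srt KIND) B -> ty_tr S B = Some b -> False.
Proof.
  intros H HB.
  destruct (conv_joinable _ _ hconf _ _ H) as (Q & H1 & H2).
  rewrite (steps_srt _ _ _ _ H1 _ eq_refl) in H2.
  destruct (steps_ty_tr _ _ _ har _ _ H2 _ HB); discriminate.
Qed.

(** * Translation of contexts and signatures *)

Lemma ctx_tr_nth_error (C : constants) (S : signature C) G g i A :
  ctx_tr S G = Some g -> nth_error G i = Some A ->
  exists a, ty_tr S A = Some a /\ nth_error g i = Some a.
Proof.
  revert g i; induction G as [|B G IH]; intros g [|i] Hg Hi;
    simpl in *; try discriminate;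
    destruct (ty_tr S B) as [b|] eqn:Hb, (ctx_tr S G) as [g'|];
    try discriminate; injection Hg as <-; eauto.
  injection Hi as <-; eauto.
Qed.

(** [is_signature] checks only arities, so [S] may hold ill-typed declarations without a
    translation. Derivations never use those, since [wt_cst] rechecks the declared type. *)
Definition translatable {C : constants} (S : signature C) : signature C :=
  fun c =>
    match S c with
    | Some (D, A) => match decl_tr S D A with
                     | Some _ => Some (D, A)
                     | None => None
                     end
    | None => None
    end.

Lemma translatable_sub (C : constants) (S : signature C) :
  sub_signature (translatable S) S.
Proof.
  intros c d; unfold translatable.
  destruct (S c) as [[D A]|]; [|discriminate].
  now destruct (decl_tr S D A).
Qed.

Lemma translatable_defined (C : constants) (S : signature C) :
  sig_tr_defined S (translatable S).
Proof.
  intros c D A; unfold translatable.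
  destruct (S c) as [[D' A']|]; [|discriminate].
  destruct (decl_tr S D' A') eqn:H; [|discriminate].
  intros [= <- <-]; eauto.
Qed.

(** One fixed name context serves all premises, so the induction never has to merge signatures. *)
Definition names_of {C : constants} (S : signature C) : names_ctx (name C) :=
  cat_names (@pi_ctx C) (sig_tr S (translatable S)).

Lemma names_of_cst (C : constants) (S : signature C) c D A t :
  S c = Some (D, A) -> decl_tr S D A = Some t -> names_of S (NCst c) t.
Proof.
  intros Hc Ht; right; exists c, D, A.
  repeat split; auto. unfold translatable; now rewrite Hc, Ht.
Qed.

(** * The invariant of typing derivations *)

Definition translates_ctx {C : constants} (S : signature C) (G : ctx C) : Prop :=
  (exists g, ctx_tr S G = Some g) /\ Forall (fun A => targets_type A = false) G.

(** The middle clause supplies the type translation of [M] when [A] is [TYPE]. It covers all kinds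
    so that it survives application and abstraction. *)
Definition classifies {C : constants} (S : signature C) (g : list stype)
    (M A : term C) : Prop :=
  exists a, ty_tr S A = Some a /\
    (targets_type A = true ->
       targets_type M = false /\ exists t, ty_tr S M = Some t) /\
    exists m, tm_tr S M = Some m /\ lwt (names_of S) g m a.

(** Kinds need their own clause: [ty_tr] is undefined on [KIND] and [tm_tr] on [TYPE]. The clause
    uses [prods_to_type] because [type_level] tests declared types with it. *)
Definition translates {C : constants} (S : signature C) (G : ctx C)
    (M A : term C) : Prop :=
  exists g, ctx_tr S G = Some g /\
    ((A = Srt KIND /\ prods_to_type M = true /\ exists t, ty_tr S M = Some t)
     \/ classifies S g M A).

(** The result type [a] is arbitrary because peeling off the last argument, of type [b], replaces it
    by [arrow b a]. *)
Definition translates_args {C : constants} (S : signature C) (G : ctx C) n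
    (ms : args C n) (D : ctx C) : Prop :=
  forall g ds h a, ctx_tr S G = Some g -> ctx_tr S D = Some ds ->
    lwt (names_of S) g h (fold_left (fun t d => arrow d t) ds a) ->
    exists m, args_tr S h ms = Some m /\ lwt (names_of S) g m a.

Lemma translates_sort (C : constants) (S : signature C) G A s :
  translates S G A (Srt s) ->
  exists a, ty_tr S A = Some a /\
    match s with
    | TYPE => targets_type A = false
    | KIND => prods_to_type A = true
    end.
Proof.
  intros (g & _ & [([= ->] & Hp & t & Ht)|(a & Ha & Hk & _)]); eauto.
  (* The sort has a translation here, so it is [TYPE], and the clause on kinds applies to it. *)
  destruct s; [|discriminate].
  destruct (Hk eq_refl) as (? & t & ?); eauto.
Qed.

Lemma translates_typed (C : constants) (S : signature C) G g M A a :
  translates S G M A -> ctx_tr S G = Some g -> ty_tr S A = Some a ->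
  (targets_type A = true ->
     targets_type M = false /\ exists t, ty_tr S M = Some t) /\
  exists m, tm_tr S M = Some m /\ lwt (names_of S) g m a.
Proof.
  intros (g' & Hg' & [(-> & _)|(a' & Ha' & H)]) Hg Ha; [discriminate|].
  now replace g with g' by congruence; replace a with a' by congruence.
Qed.

Lemma typing_translates (C : constants) (S : signature C) (R : rules C)
  (hconf : confluent R) (har : arity_preserving S R) :
  (forall G, wf S R G -> translates_ctx S G) /\
  (forall G M A, wt S R G M A -> translates S G M A) /\
  (forall G n (ms : args C n) D, wt_args S R G ms D -> translates_args S G n ms D).
Proof.
  apply typing_mutind.
  - split; simpl; eauto.
  - intros G A _ [[g Hg] HF] _ HA.
    apply translates_sort in HA as (a & Ha & Hk).
    split; [|now constructor]. simpl; rewrite Ha, Hg; eauto.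
  - intros G c D A s ms _ [[g Hg] _] Hc _ HA _ Hms.
    pose proof HA as (ds & Hds & _).
    apply translates_sort in HA as (a & Ha & Hs).
    exists g; split; [assumption|right].
    exists a; split; [now apply ty_tr_subst|].
    rewrite (targets_type_subst _ _ _ _ _ Ha). split.
    (* At sort [TYPE] the declared type is not a kind, against [Hk]; at sort [KIND] the constant is
       type-level. *)
    + intros Hk. destruct s; [congruence|].
      split; [reflexivity|]. simpl; unfold type_level; rewrite Hc, Hs; eauto.
    + apply (Hms _ _ _ _ Hg Hds), lwt_name, (names_of_cst _ _ _ _ _ _ Hc).
      unfold decl_tr; now rewrite Hds, Ha.
  - intros G _ [[g Hg] _]. exists g; split; [assumption|left]; simpl; eauto.
  - intros G i A _ [[g Hg] HF] Hi.
    destruct (ctx_tr_nth_error _ _ _ _ _ _ Hg Hi) as (a & Ha & Hgi).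
    exists g; split; [assumption|right].
    exists a; rewrite ty_tr_ren, targets_type_ren.
    split; [assumption|split].
    (* No context entry is a kind, so the clause on kinds is vacuous for variables, on which [ty_tr]
       is undefined. *)
    + rewrite Forall_forall in HF.
      rewrite (HF A); [discriminate|now apply nth_error_In in Hi].
    + eexists; split; [reflexivity|now apply lwt_var].
  - intros G M A B s _ HM _ HB Hconv.
    apply translates_sort in HB as (b & Hb & _).
    destruct HM as (g & Hg & [(-> & _)|(a & Ha & Hk & Hm)]).
    + now destruct (conv_kind_ty_tr _ _ _ hconf har _ _ Hconv Hb).
    + destruct (conv_ty_tr _ _ _ hconf har _ _ _ _ Hconv Ha Hb) as [<- HAB].
      exists g; split; [assumption|right].
      exists a; rewrite <- HAB; auto.
  - intros G A B s _ HA _ HB.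
    pose proof HA as (g & Hg & _).
    destruct (translates_sort _ _ _ _ _ HA) as (a & Ha & _).
    destruct (translates_sort _ _ _ _ _ HB) as (b & Hb & Hs).
    assert (HAB : ty_tr S (Prod A B) = Some (arrow a b))
      by (simpl; now rewrite Ha, Hb).
    (* A product of sort [KIND] needs only its type translation; at sort [TYPE] the constant [NPi a]
       types its term translation. *)
    exists g; split; [assumption|]. destruct s; [right|left; eauto].
    destruct (translates_typed _ _ _ _ _ _ star HA Hg eq_refl) as (_ & m & Hm & Hwm).
    destruct (translates_typed _ _ _ (a :: g) _ _ star HB) as (_ & n & Hn & Hwn);
      [simpl; now rewrite Ha, Hg|reflexivity|].
    exists star; split; [reflexivity|]. split; [eauto|].
    eexists; split; [simpl; rewrite Ha, Hm, Hn; reflexivity|].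
    apply lwt_app with (s := arrow a star); [|now apply lwt_lam].
    apply lwt_app with (s := star); [|assumption].
    apply lwt_name; left; now exists a.
  - intros G M N A B _ HM _ HN.
    destruct HM as (g & Hg & [([=] & _)|(ab & Hab & Hk & m & Hm & Hwm)]).
    apply ty_tr_prod_inv in Hab as (a & b & Ha & Hb & ->).
    destruct (translates_typed _ _ _ _ _ _ _ HN Hg Ha) as (_ & n & Hn & Hwn).
    exists g; split; [assumption|right].
    exists b; split; [now apply ty_tr_subst|].
    unfold subst1; rewrite (targets_type_subst _ _ _ _ _ Hb).
    (* Both maps ignore [N], so the clause on kinds for [M] is also the one for [App M N]. *)
    split; [assumption|].
    eexists; split; [simpl; now rewrite Hm, Hn|eapply lwt_app; eauto].
  - intros G A B M s _ HA _ HB _ HM.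
    pose proof HA as (g & Hg & _).
    destruct (translates_sort _ _ _ _ _ HA) as (a & Ha & _).
    destruct (translates_sort _ _ _ _ _ HB) as (b & Hb & _).
    destruct (translates_typed _ _ _ _ _ _ star HA Hg eq_refl) as (_ & n & Hn & Hwn).
    destruct (translates_typed _ _ _ (a :: g) _ _ b HM) as (Hk & m & Hm & Hwm);
      [simpl; now rewrite Ha, Hg|assumption|].
    exists g; split; [assumption|right].
    exists (arrow a b); split; [simpl; now rewrite Ha, Hb|].
    split; [assumption|].
    eexists; split; [simpl; rewrite Hn, Hm; reflexivity|].
    (* [star] is the type of the fresh outer variable, which receives the translation of [A]; the
       shift is weakening by that variable. *)
    apply lwt_app with (s := star); [|assumption].
    now apply lwt_lam, lwt_lshift, lwt_lam.
  - intros G g ds h a _ [= <-] Hh. simpl in *; eauto.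
  - intros G n ms M D A _ IH _ HM g ds h a Hg Hds Hh.
    simpl in Hds.
    destruct (ty_tr S A) as [b|] eqn:Hb, (ctx_tr S D) as [ds'|] eqn:Hds';
      try discriminate.
    injection Hds as <-.
    destruct (translates_typed _ _ _ _ _ _ b HM Hg) as (_ & m & Hm & Hwm);
      [now apply ty_tr_subst|].
    destruct (IH _ _ h (arrow b a) Hg Hds' Hh) as (t & Ht & Hwt).
    eexists; split; [simpl; now rewrite Ht, Hm|eapply lwt_app; eauto].
Qed.

Theorem mainTheorem6 (C : constants) (S : signature C) (R : rules C)
  (hS : is_signature S) (hconf : confluent R) (har : arity_preserving S R)
  (G : ctx C) (M A : term C) (hM : wt S R G M A) (hA : A <> Srt KIND) :
  exists S' : signature C,
    sub_signature S' S /\ sig_tr_defined S S' /\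
    exists (g : list stype) (m : lterm (name C)) (a : stype),
      ctx_tr S G = Some g /\ tm_tr S M = Some m /\ ty_tr S A = Some a /\
      lwt (cat_names (@pi_ctx C) (sig_tr S S')) g m a.
Proof.
  exists (translatable S).
  split; [apply translatable_sub|split; [apply translatable_defined|]].
  destruct (proj1 (proj2 (typing_translates _ _ _ hconf har)) _ _ _ hM)
    as (g & Hg & [[? _]|(a & Ha & _ & m & Hm & Hw)]); [contradiction|].
  now exists g, m, a.
Qed.
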